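(* Let $k$ be a field. Let $\mathrm{eval},\mathrm{feed}\colon\Box(\mathtt{FinVect}_k)\to\mathtt{FinVect}_k$ and $\mathrm{Box}\colon\mathtt{FinVect}_k\to\Box(\mathtt{FinVect}_k)$ be the identity on objects and be given on morphisms by $\mathrm{eval}(d,c,a,b)=d+cab$, $\mathrm{feed}(d,c,a,b)=d$, and $\mathrm{Box}(d)=(d,!,0,0)$, the quadruple with $d$ in the first entry, both intermediate spaces $S=T=0$, and the unique (zero) maps in the other entries. Then $\mathrm{eval}$, $\mathrm{feed}$ and $\mathrm{Box}$ are functors which are PROP morphisms, and (i) $\mathrm{eval}$ and $\mathrm{feed}$ are full, but not faithful; (ii) $\mathrm{Box}$ is faithful, but not full; (iii) $\mathrm{Box}$ does not preserve limits or colimits; in particular, $\mathrm{Box}$ has no adjoint (neither left nor right).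
   Context: A PROP is a strict symmetric monoidal category whose objects are the natural numbers, with monoidal product of objects given by addition. A PROP morphism is a strict symmetric monoidal functor sending $1$ to $1$. $\mathtt{FinVect}_k$ is the PROP whose objects are the vector spaces $k^n$ (identified with $n\in\mathbb N$), with linear maps as morphisms and direct sum as tensor product. $\Box(\mathtt{FinVect}_k)$ has the same objects as $\mathtt{FinVect}_k$. A morphism $V_1\to V_2$ is an equivalence class of quadruples $(d,c,a,b)$ of linear maps in $\mathtt{FinVect}_k$, with $d\colon V_1\to V_2$, $b\colon V_1\to S$, $a\colon S\to T$, $c\colon T\to V_2$ for some objects $S,T$. Two quadruples $(d,c,a,b)$ (with spaces $S,T$) and $(d,c',a',b')$ (with spaces $S',T'$) are equivalent if there are isomorphisms $\alpha\colon S\to S'$ and $\omega\colon T\to T'$ with $\alpha b=b'$, $\omega a=a'\alpha$, $c=c'\omega$. Composition is $$(d',c',a',b')\circ(d,c,a,b)=\Big(d'd,\ [\,d'c\ \ c'\,],\ \begin{bmatrix} a & 0 \\ {a'b'ca} & a' \end{bmatrix},\ \begin{bmatrix} b \\ {b'd} \end{bmatrix}\Big),$$ with intermediate spaces $S\oplus S'$ and $T\oplus T'$. The monoidal product is direct sum on objects and entrywise direct sum on morphisms. Identities and symmetries are those of $\mathtt{FinVect}_k$ placed in the first entry, with $S=T=0$. *)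

(* Defs.v *)
From HB Require Import structures.
From mathcomp Require Import all_boot all_algebra.
From mathcomp Require Import generic_quotient boolp.

Set Implicit Arguments.
Unset Strict Implicit.
Unset Printing Implicit Defensive.

Import GRing.Theory.

Declare Scope cat_scope.
Delimit Scope cat_scope with cat.
Local Open Scope cat_scope.

Record category := Category {
  obj :> Type;
  hom : obj -> obj -> Type;
  idm : forall x, hom x x;
  comp : forall x y z, hom y z -> hom x y -> hom x z;
  comp1m : forall x y (f : hom x y), comp (idm y) f = f;
  compm1 : forall x y (f : hom x y), comp f (idm x) = f;
  compA : forall w x y z (h : hom y z) (g : hom x y) (f : hom w x),
    comp h (comp g f) = comp (comp h g) f }.

Arguments hom {c} x y.
Arguments idm {c} x.
Arguments comp {c x y z} g f.

Notation "g '\oc' f" := (comp g f) (at level 40, left associativity) : cat_scope.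

Record is_functor (C D : category) (F0 : C -> D)
    (F1 : forall x y : C, hom x y -> hom (F0 x) (F0 y)) : Prop := IsFunctor {
  functor_id : forall x, F1 x x (idm x) = idm (F0 x);
  functor_comp : forall x y z (g : hom y z) (f : hom x y),
    F1 x z (g \oc f) = F1 y z g \oc F1 x y f }.

Record functor (C D : category) := Functor {
  fobj :> C -> D;
  fmor : forall x y : C, hom x y -> hom (fobj x) (fobj y);
  functorP : is_functor fmor }.

Arguments Functor {C D fobj fmor} functorP.
Arguments fmor {C D} f {x y}.

Definition full (C D : category) (F : functor C D) : Prop :=
  forall (x y : C) (g : hom (F x) (F y)), exists f : hom x y, fmor F f = g.

Definition faithful (C D : category) (F : functor C D) : Prop :=
  forall x y : C, injective (fun f : hom x y => fmor F f).

Definition is_cone (J C : category) (D : functor J C) (L : C)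
    (p : forall j, hom L (D j)) : Prop :=
  forall (i j : J) (u : hom i j), fmor D u \oc p i = p j.

Definition is_limit (J C : category) (D : functor J C) (L : C)
    (p : forall j, hom L (D j)) : Prop :=
  is_cone p /\
  forall (X : C) (q : forall j, hom X (D j)), is_cone q ->
    exists! h : hom X L, forall j, p j \oc h = q j.

Definition is_cocone (J C : category) (D : functor J C) (L : C)
    (p : forall j, hom (D j) L) : Prop :=
  forall (i j : J) (u : hom i j), p j \oc fmor D u = p i.

Definition is_colimit (J C : category) (D : functor J C) (L : C)
    (p : forall j, hom (D j) L) : Prop :=
  is_cocone p /\
  forall (X : C) (q : forall j, hom (D j) X), is_cocone q ->
    exists! h : hom L X, forall j, h \oc p j = q j.

Lemma comp_is_functor (C D E : category) (G : functor D E) (F : functor C D) :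
  is_functor (F0 := fun x => G (F x)) (fun x y (f : hom x y) => fmor G (fmor F f)).
Proof.
split=> [x|x y z g f].
  by rewrite (functor_id (functorP F)) (functor_id (functorP G)).
by rewrite (functor_comp (functorP F)) (functor_comp (functorP G)).
Qed.

Definition comp_functor (C D E : category) (G : functor D E) (F : functor C D) :
  functor C E := Functor (comp_is_functor G F).

Definition preserves_limits (C D : category) (F : functor C D) : Prop :=
  forall (J : category) (K : functor J C) (L : C) (p : forall j, hom L (K j)),
    is_limit p -> is_limit (D := comp_functor F K) (fun j => fmor F (p j)).

Definition preserves_colimits (C D : category) (F : functor C D) : Prop :=
  forall (J : category) (K : functor J C) (L : C) (p : forall j, hom (K j) L),
    is_colimit p -> is_colimit (D := comp_functor F K) (fun j => fmor F (p j)).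

Definition adjoint (C D : category) (F : functor C D) (G : functor D C) : Prop :=
  exists phi : forall (x : C) (y : D), hom (F x) y -> hom x (G y),
    [/\ forall x y, bijective (phi x y),
        forall x x' y (f : hom x' x) (g : hom (F x) y),
          phi x' y (g \oc fmor F f) = phi x y g \oc f
      & forall x y y' (g : hom (F x) y) (h : hom y y'),
          phi x y' (h \oc g) = fmor G h \oc phi x y g].

Definition has_right_adjoint (C D : category) (F : functor C D) : Prop :=
  exists G : functor D C, adjoint F G.

Definition has_left_adjoint (C D : category) (F : functor C D) : Prop :=
  exists G : functor D C, adjoint G F.

(* Transport of a morphism along equalities of its source and target; it
   expresses the strictness equations, which hold between morphisms whose
   types are only propositionally equal. *)
Definition hom_cast (I : Type) (H : I -> I -> Type) (x x' y y' : I)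
    (ex : x = x') (ey : y = y') (f : H x y) : H x' y' :=
  eq_rect y (H x') (eq_rect x (fun z => H z y) f x' ex) y' ey.

(* The unit of the monoidal product is the object 0; the coherence of the
   symmetry with the unit follows from prop_symK and prop_sym_hex. *)
Record PROP := MkPROP {
  prop_hom : nat -> nat -> Type;
  prop_id : forall n, prop_hom n n;
  prop_comp : forall m n p, prop_hom n p -> prop_hom m n -> prop_hom m p;
  prop_comp1m : forall m n (f : prop_hom m n), prop_comp (prop_id n) f = f;
  prop_compm1 : forall m n (f : prop_hom m n), prop_comp f (prop_id m) = f;
  prop_compA : forall m n p q
    (h : prop_hom p q) (g : prop_hom n p) (f : prop_hom m n),
    prop_comp h (prop_comp g f) = prop_comp (prop_comp h g) f;
  prop_tens : forall m n m' n',
    prop_hom m n -> prop_hom m' n' -> prop_hom (m + m') (n + n');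
  prop_tens_id : forall m n, prop_tens (prop_id m) (prop_id n) = prop_id (m + n);
  prop_tens_comp : forall m n p m' n' p'
    (g : prop_hom n p) (f : prop_hom m n)
    (g' : prop_hom n' p') (f' : prop_hom m' n'),
    prop_tens (prop_comp g f) (prop_comp g' f')
    = prop_comp (prop_tens g g') (prop_tens f f');
  prop_tensA : forall m n m' n' m'' n''
    (f : prop_hom m n) (g : prop_hom m' n') (h : prop_hom m'' n''),
    hom_cast (addnA m m' m'') (addnA n n' n'') (prop_tens f (prop_tens g h))
    = prop_tens (prop_tens f g) h;
  prop_tens0m : forall m n (f : prop_hom m n),
    hom_cast (add0n m) (add0n n) (prop_tens (prop_id 0) f) = f;
  prop_tensm0 : forall m n (f : prop_hom m n),
    hom_cast (addn0 m) (addn0 n) (prop_tens f (prop_id 0)) = f;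
  prop_sym : forall m n, prop_hom (m + n) (n + m);
  prop_sym_nat : forall m n m' n' (f : prop_hom m n) (g : prop_hom m' n'),
    prop_comp (prop_sym n n') (prop_tens f g)
    = prop_comp (prop_tens g f) (prop_sym m m');
  prop_symK : forall m n,
    prop_comp (prop_sym n m) (prop_sym m n) = prop_id (m + n);
  prop_sym_hex : forall m n p,
    prop_sym m (n + p)
    = prop_comp
        (hom_cast erefl (addnA n p m) (prop_tens (prop_id n) (prop_sym m p)))
        (hom_cast (esym (addnA m n p)) (esym (addnA n m p))
           (prop_tens (prop_sym m n) (prop_id p))) }.

Arguments prop_tens {p m n m' n'} f g : rename.
Arguments prop_sym {p} m n : rename.

Definition PROP_category (P : PROP) : category :=
  Category (@prop_comp1m P) (@prop_compm1 P) (@prop_compA P).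
Coercion PROP_category : PROP >-> category.

(* The functor is strict on objects (F0D) and on morphisms up to transport along
   F0D; equality proofs on nat being unique, the choice of F0D is immaterial. *)
Definition PROP_morphism (P Q : PROP) (F : functor P Q) : Prop :=
  let F0 : nat -> nat := F in
  let F1 (m n : nat) (f : prop_hom P m n) : prop_hom Q (F0 m) (F0 n) :=
    @fmor P Q F m n f in
  exists F0D : forall m n : nat, F0 m + F0 n = F0 (m + n),
    [/\ F0 0 = 0,
        F0 1 = 1,
        forall (m n m' n' : nat) (f : prop_hom P m n) (g : prop_hom P m' n'),
          F1 _ _ (prop_tens f g)
          = hom_cast (F0D m m') (F0D n n') (prop_tens (F1 _ _ f) (F1 _ _ g))
      & forall m n : nat,
          F1 _ _ (prop_sym m n) = hom_cast (F0D m n) (F0D n m) (prop_sym (F0 m) (F0 n))].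

Local Open Scope ring_scope.
Local Open Scope quotient_scope.

Section FinVect.
Variable k : fieldType.

(* A linear map k^m -> k^n is a matrix with n rows and m columns, acting on
   column vectors, so that composition is the matrix product. *)
Definition lmap (m n : nat) : Type := 'M[k]_(n, m).

Definition dsum m n m' n' (f : lmap m n) (g : lmap m' n') :
  lmap (m + m') (n + n') := block_mx f 0 0 g.

Definition swap m n : lmap (m + n) (n + m) := block_mx 0 1%:M 1%:M 0.

Lemma hom_cast_lmap m m' n n' (em : m = m') (en : n = n') (f : lmap m n) :
  hom_cast em en f = castmx (en, em) f.
Proof. by case: m' / em; case: n' / en; rewrite castmx_id. Qed.

Lemma dsum_id m n : dsum (1%:M : lmap m m) (1%:M : lmap n n) = 1%:M.
Proof. by rewrite /dsum -scalar_mx_block. Qed.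

Lemma dsum_comp m n p m' n' p' (g : lmap n p) (f : lmap m n)
    (g' : lmap n' p') (f' : lmap m' n') :
  dsum (g *m f : lmap m p) (g' *m f' : lmap m' p') = dsum g g' *m dsum f f'.
Proof. by rewrite /dsum mulmx_block !mulmx0 !mul0mx !addr0 !add0r. Qed.

Lemma dsumA m n m' n' m'' n'' (f : lmap m n) (g : lmap m' n') (h : lmap m'' n'') :
  hom_cast (addnA m m' m'') (addnA n n' n'') (dsum f (dsum g h))
  = dsum (dsum f g) h.
Proof.
rewrite hom_cast_lmap /dsum.
have := @block_mxA k n n' n'' m m' m'' f 0 0 0 g 0 0 0 h; rewrite /= !row_mx0 !col_mx0 => ->.
by rewrite castmx_comp castmx_id.
Qed.

Lemma dsum0m m n (f : lmap m n) :
  hom_cast (add0n m) (add0n n) (dsum (1%:M : lmap 0 0) f) = f.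
Proof.
rewrite hom_cast_lmap; apply/matrixP => i j; rewrite castmxE /dsum.
have -> : cast_ord (esym (add0n n)) i = rshift 0 i by apply: val_inj.
have -> : cast_ord (esym (add0n m)) j = rshift 0 j by apply: val_inj.
by rewrite block_mxEdr.
Qed.

Lemma dsumm0 m n (f : lmap m n) :
  hom_cast (addn0 m) (addn0 n) (dsum f (1%:M : lmap 0 0)) = f.
Proof.
rewrite hom_cast_lmap; apply/matrixP => i j; rewrite castmxE /dsum.
have -> : cast_ord (esym (addn0 n)) i = lshift 0 i by apply: val_inj.
have -> : cast_ord (esym (addn0 m)) j = lshift 0 j by apply: val_inj.
by rewrite block_mxEul.
Qed.

Lemma swap_nat m n m' n' (f : lmap m n) (g : lmap m' n') :
  swap n n' *m dsum f g = dsum g f *m swap m m'.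
Proof.
by rewrite /swap /dsum !mulmx_block !mulmx0 !mul0mx !mul1mx !mulmx1 !addr0 !add0r.
Qed.

Lemma swapK m n : swap n m *m swap m n = 1%:M.
Proof.
by rewrite /swap mulmx_block !mulmx0 !mul0mx !mul1mx !addr0 !add0r -scalar_mx_block.
Qed.

Lemma swap_hex m n p :
  swap m (n + p)
  = (hom_cast erefl (addnA n p m) (dsum (1%:M : lmap n n) (swap m p)) : lmap _ _)
    *m (hom_cast (esym (addnA m n p)) (esym (addnA n m p))
          (dsum (swap m n) (1%:M : lmap p p)) : lmap _ _).
Proof.
rewrite !hom_cast_lmap.
have -> : castmx (esym (addnA n m p), esym (addnA m n p))
    (dsum (swap m n) (1%:M : lmap p p))
  = block_mx 0 (row_mx 1%:M 0) (col_mx 1%:M 0) (block_mx 0 0 0 1%:M).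
  have := @block_mxA k n m p m n p 0 1%:M 0 1%:M 0 0 0 0 1%:M.
  by rewrite /= !row_mx0 !col_mx0 => ->; apply: eq_castmx.
have castl (q r s : nat) (e : r = s) (A : 'M[k]_(r, q)) t (B : 'M[k]_(q, t)) :
  castmx (e, erefl) A *m B = castmx (e, erefl) (A *m B).
  by case: s / e; rewrite !castmx_id.
rewrite castl /dsum /swap mulmx_block !mulmx0 !mul0mx !mul1mx !addr0 !add0r.
rewrite mul_block_col mulmx_block !mulmx0 !mul0mx !mul1mx !addr0 !add0r.
rewrite [block_mx _ (row_mx _ _) _ _]block_mxEv.
have -> : row_mx (col_mx 0 1%:M) (block_mx 0 1%:M 0 0)
  = col_mx (row_mx 0 (row_mx 0 1%:M)) (row_mx 1%:M 0) :> 'M[k]_(p + m, m + (n + p)).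
  by rewrite block_mxEv -block_mxEh row_mx0 block_mxEv.
rewrite col_mxA castmx_comp castmx_id block_mxEv; congr col_mx.
by rewrite -block_mxEv block_mxEh col_mx0 -block_mxEv -scalar_mx_block.
Qed.

Definition FinVect : PROP := @MkPROP
  lmap (fun n => 1%:M) (fun m n p (g : lmap n p) (f : lmap m n) => g *m f)
  (fun m n f => mul1mx f) (fun m n f => mulmx1 f)
  (fun m n p q h g f => mulmxA h g f)
  dsum dsum_id dsum_comp dsumA dsum0m dsumm0
  swap swap_nat swapK swap_hex.

End FinVect.

Section Box.
Variable k : fieldType.
Local Notation lmap := (lmap k).

(* quad_S and quad_T are the intermediate spaces k^S and k^T. *)
Record quad (m n : nat) := Quad {
  quad_S : nat;
  quad_T : nat;
  quad_d : lmap m n;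
  quad_c : lmap quad_T n;
  quad_a : lmap quad_S quad_T;
  quad_b : lmap m quad_S }.

Definition is_iso m n (f : lmap m n) : Prop :=
  exists g : lmap n m, g *m f = 1%:M /\ f *m g = 1%:M.

Definition quad_eqv m n (q q' : quad m n) : Prop :=
  quad_d q = quad_d q' /\
  exists (alpha : lmap (quad_S q) (quad_S q')) (omega : lmap (quad_T q) (quad_T q')),
    [/\ is_iso alpha, is_iso omega,
        alpha *m quad_b q = quad_b q',
        omega *m quad_a q = quad_a q' *m alpha
      & quad_c q = quad_c q' *m omega].

(* The choice structure on quadruples is only needed to form the quotient. *)
Definition quad_enc m n (q : quad m n) :
    {st : nat * nat & ('M[k]_(n, m) * 'M[k]_(n, st.2)
                       * 'M[k]_(st.2, st.1) * 'M[k]_(st.1, m))%type} :=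
  existT _ (quad_S q, quad_T q) (quad_d q, quad_c q, quad_a q, quad_b q).

Definition quad_dec m n
    (x : {st : nat * nat & ('M[k]_(n, m) * 'M[k]_(n, st.2)
                       * 'M[k]_(st.2, st.1) * 'M[k]_(st.1, m))%type}) : quad m n :=
  let: existT st (d, c, a, b) := x in @Quad m n st.1 st.2 d c a b.

Lemma quad_encK m n : cancel (@quad_enc m n) (@quad_dec m n).
Proof. by case. Qed.

HB.instance Definition _ m n := Choice.copy (quad m n) (can_type (@quad_encK m n)).

Lemma is_iso1 n : is_iso (1%:M : lmap n n).
Proof. by exists 1%:M; rewrite mulmx1. Qed.

Lemma is_iso_comp m n p (g : lmap n p) (f : lmap m n) :
  is_iso g -> is_iso f -> is_iso (g *m f : lmap m p).
Proof.
move=> [g' [g'g gg']] [f' [f'f ff']]; exists (f' *m g'); split.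
  by rewrite mulmxA -(mulmxA f') g'g mulmx1.
by rewrite mulmxA -(mulmxA g) ff' mulmx1.
Qed.

Lemma is_iso_dsum m n m' n' (f : lmap m n) (f' : lmap m' n') :
  is_iso f -> is_iso f' -> is_iso (dsum f f').
Proof.
by move=> [g [gf fg]] [g' [gf' fg']]; exists (dsum g g');
  rewrite -!dsum_comp gf fg gf' fg' !dsum_id.
Qed.

Lemma quad_eqv_refl m n (q : quad m n) : quad_eqv q q.
Proof.
split=> //; exists 1%:M, 1%:M.
by split; rewrite ?mul1mx ?mulmx1 //; apply: is_iso1.
Qed.

Lemma quad_eqv_sym m n (q q' : quad m n) : quad_eqv q q' -> quad_eqv q' q.
Proof.
move=> [Ed [u [w [[u' [u'u uu']] [w' [w'w ww']] Eb Ea Ec]]]].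
split=> //; exists u', w'; split.
- by exists u.
- by exists w.
- by rewrite -Eb mulmxA u'u mul1mx.
- by rewrite -[quad_a q']mulmx1 -uu' (mulmxA (quad_a q')) -Ea !mulmxA w'w mul1mx.
- by rewrite Ec -mulmxA ww' mulmx1.
Qed.

Lemma quad_eqv_trans m n (q q' q'' : quad m n) :
  quad_eqv q q' -> quad_eqv q' q'' -> quad_eqv q q''.
Proof.
move=> [Ed [u [w [iu iw Eb Ea Ec]]]] [Ed' [u' [w' [iu' iw' Eb' Ea' Ec']]]].
split; first by rewrite Ed.
exists (u' *m u), (w' *m w); split; try exact: is_iso_comp.
- by rewrite -mulmxA Eb.
- by rewrite -mulmxA Ea mulmxA Ea' mulmxA.
- by rewrite Ec Ec' mulmxA.
Qed.

Definition quad_eqvb m n : rel (quad m n) := fun q q' => `[< quad_eqv q q' >].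

Lemma quad_eqvb_refl m n : reflexive (@quad_eqvb m n).
Proof. by move=> q; apply/asboolP/quad_eqv_refl. Qed.

Lemma quad_eqvb_sym m n : symmetric (@quad_eqvb m n).
Proof. by move=> q q'; apply/asboolP/asboolP; apply: quad_eqv_sym. Qed.

Lemma quad_eqvb_trans m n : transitive (@quad_eqvb m n).
Proof.
move=> q q' q'' /asboolP h /asboolP h'; apply/asboolP.
exact: quad_eqv_trans h h'.
Qed.

Canonical quad_equiv m n := EquivRel (@quad_eqvb m n)
  (@quad_eqvb_refl m n) (@quad_eqvb_sym m n) (@quad_eqvb_trans m n).

Definition box_hom (m n : nat) : Type := {eq_quot (@quad_eqvb m n)}.

Definition box_class m n (q : quad m n) : box_hom m n :=
  \pi_({eq_quot (@quad_eqvb m n)}) q.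

Definition box_repr m n (x : box_hom m n) : quad m n := repr x.

Lemma box_reprK m n (x : box_hom m n) : box_class (box_repr x) = x.
Proof. exact: reprK. Qed.

Lemma box_classP m n (q q' : quad m n) :
  box_class q = box_class q' <-> quad_eqv q q'.
Proof.
split=> [/eqmodP/asboolP //|h].
by apply/eqmodP/asboolP.
Qed.

Lemma box_ind m n (P : box_hom m n -> Prop) :
  (forall q, P (box_class q)) -> forall x, P x.
Proof. by move=> h x; rewrite -[x]box_reprK. Qed.

Lemma box_repr_class m n (q : quad m n) : quad_eqv (box_repr (box_class q)) q.
Proof. by apply/box_classP; rewrite box_reprK. Qed.

Definition quad_of m n (d : lmap m n) : quad m n :=
  @Quad m n 0 0 d 0 0 0.

Definition quad_comp m n p (q' : quad n p) (q : quad m n) : quad m p :=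
  let: Quad s t d c a b := q in
  let: Quad s' t' d' c' a' b' := q' in
  @Quad m p (s + s') (t + t')
    (d' *m d)
    (row_mx (d' *m c) c')
    (block_mx a 0 (a' *m b' *m c *m a) a')
    (col_mx b (b' *m d)).

Definition quad_tens m n m' n' (q : quad m n) (q' : quad m' n') :
    quad (m + m') (n + n') :=
  let: Quad s t d c a b := q in
  let: Quad s' t' d' c' a' b' := q' in
  @Quad (m + m') (n + n') (s + s') (t + t')
    (dsum d d') (dsum c c') (dsum a a') (dsum b b').

(* Composition and monoidal product of classes are computed on
   representatives; see box_comp_class and box_tens_class. *)
Definition box_mor m n (d : lmap m n) : box_hom m n := box_class (quad_of d).

Definition box_id n : box_hom n n := box_mor 1%:M.

Definition box_comp m n p (x' : box_hom n p) (x : box_hom m n) : box_hom m p :=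
  box_class (quad_comp (box_repr x') (box_repr x)).

Definition box_tens m n m' n' (x : box_hom m n) (x' : box_hom m' n') :
    box_hom (m + m') (n + n') :=
  box_class (quad_tens (box_repr x) (box_repr x')).

Definition box_swap m n : box_hom (m + n) (n + m) :=
  box_mor (swap k m n).

Local Notation mx0 := (mulmx0, mul0mx, addr0, add0r, mul1mx, mulmx1).

Lemma quad_comp_eqv m n p (r r' : quad n p) (q q' : quad m n) :
  quad_eqv r r' -> quad_eqv q q' -> quad_eqv (quad_comp r q) (quad_comp r' q').
Proof.
case: r r' q q' => [S1 T1 d1 c1 a1 b1] [S1' T1' d1' c1' a1' b1'].
move=> [S T d c a b] [S' T' d' c' a' b'] [/= E1d [u1 [w1 [iu1 iw1 E1b E1a E1c]]]].
move=> [/= Ed [u [w [iu iw Eb Ea Ec]]]]; rewrite /quad_comp.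
split=> /=; first by rewrite E1d Ed.
exists (dsum u u1), (dsum w w1); split=> /=; try exact: is_iso_dsum.
- by rewrite /dsum mul_block_col !mx0 Eb mulmxA E1b Ed.
- rewrite /dsum !mulmx_block !mx0 Ea E1a; congr block_mx.
  by rewrite !mulmxA E1a -[_ *m u1 *m b1]mulmxA E1b Ec -!mulmxA Ea.
- by rewrite /dsum mul_row_block !mx0 Ec E1c E1d mulmxA.
Qed.

Lemma quad_tens_eqv m n m' n' (q r : quad m n) (q' r' : quad m' n') :
  quad_eqv q r -> quad_eqv q' r' -> quad_eqv (quad_tens q q') (quad_tens r r').
Proof.
case: q r q' r' => [S1 T1 d1 c1 a1 b1] [S1' T1' d1' c1' a1' b1'].
move=> [S T d c a b] [S' T' d' c' a' b'] [/= E1d [u1 [w1 [iu1 iw1 E1b E1a E1c]]]].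
move=> [/= Ed [u [w [iu iw Eb Ea Ec]]]]; rewrite /quad_tens.
split=> /=; first by rewrite E1d Ed.
exists (dsum u1 u), (dsum w1 w); split=> /=; try exact: is_iso_dsum.
- by rewrite -dsum_comp E1b Eb.
- by rewrite -!dsum_comp E1a Ea.
- by rewrite -dsum_comp -E1c Ec.
Qed.

Lemma box_comp_class m n p (q' : quad n p) (q : quad m n) :
  box_comp (box_class q') (box_class q) = box_class (quad_comp q' q).
Proof. by apply/box_classP; apply: quad_comp_eqv; apply: box_repr_class. Qed.

Lemma box_tens_class m n m' n' (q : quad m n) (q' : quad m' n') :
  box_tens (box_class q) (box_class q') = box_class (quad_tens q q').
Proof. by apply/box_classP; apply: quad_tens_eqv; apply: box_repr_class. Qed.

(* Quadruples that agree up to reindexing of the intermediate spaces. *)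
Lemma quad_eqv_cast m n S S' T T' (eS : S = S') (eT : T = T')
    (d d' : lmap m n) (c : lmap T n) (a : lmap S T) (b : lmap m S)
    (c' : lmap T' n) (a' : lmap S' T') (b' : lmap m S') :
  d = d' -> castmx (erefl, eT) c = c' -> castmx (eT, eS) a = a' ->
  castmx (eS, erefl) b = b' -> quad_eqv (Quad d c a b) (Quad d' c' a' b').
Proof.
case: S' / eS a' b'; case: T' / eT c' => c' a' b' <-; rewrite !castmx_id => <- <- <-.
exact: quad_eqv_refl.
Qed.

Lemma box_mor_compl m n p (f : lmap n p) (q : quad m n) :
  box_comp (box_mor f) (box_class q)
  = box_class (@Quad m p _ _ (f *m quad_d q) (f *m quad_c q) (quad_a q) (quad_b q)).
Proof.
case: q => [S T d c a b]; rewrite /box_mor box_comp_class /=; apply/box_classP.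
have iso0 (s : nat) : is_iso (row_mx 1%:M 0 : lmap (s + 0) s).
  exists (col_mx 1%:M 0); rewrite mul_col_row mul_row_col !mx0; split=> //.
  by rewrite [RHS](scalar_mx_block s 0); congr block_mx; apply/matrixP=> -[].
split=> //=; exists (row_mx 1%:M 0), (row_mx 1%:M 0); split=> //=.
- by rewrite mul_row_col !mx0.
- by rewrite mul_row_block mul_mx_row !mx0.
- by rewrite mul_mx_row !mx0.
Qed.

Lemma box_mor_compr m n p (f : lmap m n) (q : quad n p) :
  box_comp (box_class q) (box_mor f)
  = box_class (@Quad m p _ _ (quad_d q *m f) (quad_c q) (quad_a q) (quad_b q *m f)).
Proof.
case: q => [S T d c a b]; rewrite /box_mor box_comp_class /=; apply/box_classP.
have iso0 (s : nat) : is_iso (row_mx 0 1%:M : lmap (0 + s) s).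
  exists (col_mx 0 1%:M); rewrite mul_col_row mul_row_col !mx0; split=> //.
  by rewrite [RHS](scalar_mx_block 0 s); congr block_mx; apply/matrixP=> -[].
split=> //=; exists (row_mx 0 1%:M), (row_mx 0 1%:M); split=> //=.
- by rewrite mul_row_col !mx0.
- by rewrite mul_row_block mul_mx_row !mx0.
- by rewrite mul_mx_row !mx0.
Qed.

Lemma box_comp1m m n (x : box_hom m n) : box_comp (box_id n) x = x.
Proof.
by elim/box_ind: x => [[S T d c a b]]; rewrite box_mor_compl /= !mul1mx.
Qed.

Lemma box_compm1 m n (x : box_hom m n) : box_comp x (box_id m) = x.
Proof.
by elim/box_ind: x => [[S T d c a b]]; rewrite box_mor_compr /= !mulmx1.
Qed.

Lemma box_compA m n p r (z : box_hom p r) (y : box_hom n p) (x : box_hom m n) :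
  box_comp z (box_comp y x) = box_comp (box_comp z y) x.
Proof.
elim/box_ind: x => [[S T d c a b]]; elim/box_ind: y => [[S' T' d' c' a' b']].
elim/box_ind: z => [[S'' T'' d'' c'' a'' b'']].
rewrite !box_comp_class; apply/box_classP; rewrite /quad_comp.
apply: (quad_eqv_cast (eS := esym (addnA _ _ _)) (eT := esym (addnA _ _ _))).
- by rewrite mulmxA.
- by rewrite [RHS]row_mxA !mul_mx_row mulmxA.
- rewrite mul_mx_row mul_row_block !mx0.
  rewrite mul_block_col !mx0 !mul_col_mx -[X in _ = block_mx _ X _ _]row_mx0.
  by rewrite [RHS]block_mxA col_mx0 !mulmxDl [in LHS]addrC !mulmxA.
- by rewrite mul_col_mx [RHS]col_mxA !mulmxA.
Qed.

Lemma box_tens_mor m n m' n' (f : lmap m n) (g : lmap m' n') :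
  box_tens (box_mor f) (box_mor g) = box_mor (dsum f g).
Proof.
rewrite /box_mor box_tens_class /=; congr box_class.
by congr (@Quad _ _ 0 0); apply/matrixP=> [] i []; move: i => [].
Qed.

Lemma box_comp_mor m n p (g : lmap n p) (f : lmap m n) :
  box_comp (box_mor g) (box_mor f) = box_mor (g *m f).
Proof. by rewrite box_mor_compl /= mulmx0. Qed.

Lemma box_tens_id m n : box_tens (box_id m) (box_id n) = box_id (m + n).
Proof. by rewrite box_tens_mor dsum_id. Qed.

(* The middle interchange k^(p+q) + k^(r+s) -> k^(p+r) + k^(q+s). *)
Definition mid p q r s : lmap ((p + q) + (r + s)) ((p + r) + (q + s)) :=
  block_mx (block_mx 1%:M 0 0 0) (block_mx 0 0 1%:M 0)
           (block_mx 0 1%:M 0 0) (block_mx 0 0 0 1%:M).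

Lemma midK p q r s : mid p r q s *m mid p q r s = 1%:M.
Proof.
rewrite /mid !mulmx_block !mx0 !add_block_mx !mx0 !block_mx0.
by rewrite -!scalar_mx_block.
Qed.

Lemma is_iso_mid p q r s : is_iso (mid p q r s).
Proof. by exists (mid p r q s); rewrite !midK. Qed.

Lemma box_tens_comp m n p m' n' p' (g : box_hom n p) (f : box_hom m n)
    (g' : box_hom n' p') (f' : box_hom m' n') :
  box_tens (box_comp g f) (box_comp g' f')
  = box_comp (box_tens g g') (box_tens f f').
Proof.
elim/box_ind: g => [[S T d c a b]]; elim/box_ind: f => [[S1 T1 d1 c1 a1 b1]].
elim/box_ind: g' => [[S' T' d' c' a' b']].
elim/box_ind: f' => [[S1' T1' d1' c1' a1' b1']].
rewrite (box_tens_class (Quad d _ _ _)) (box_tens_class (Quad d1 _ _ _)).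
rewrite !box_comp_class box_tens_class; apply/box_classP.
rewrite /quad_comp /quad_tens; split=> /=; first by rewrite dsum_comp.
exists (mid S1 S S1' S'), (mid T1 T T1' T'); split=> /=; try exact: is_iso_mid.
- rewrite /mid /dsum !mulmx_block !mul_block_col !mx0.
  by rewrite block_mxEv -!block_mxEh.
- by rewrite /mid /dsum !mulmx_block !mx0 !add_block_mx !mx0.
- rewrite /mid /dsum !mulmx_block !mul_row_block !mulmx_block !add_block_mx !mx0.
  by rewrite [in RHS]block_mxEv [block_mx 0 0 _ _]block_mxEv -block_mxEh !row_mx0.
Qed.

Lemma hom_cast_box m m' n n' (em : m = m') (en : n = n') (q : quad m n) :
  hom_cast em en (box_class q)
  = box_class (@Quad m' n' _ _ (castmx (en, em) (quad_d q))
                 (castmx (en, erefl) (quad_c q)) (quad_a q)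
                 (castmx (erefl, em) (quad_b q))).
Proof.
by case: m' / em; case: n' / en; rewrite /hom_cast /= !castmx_id; case: q.
Qed.

Lemma hom_cast_box_mor m m' n n' (em : m = m') (en : n = n') (f : lmap m n) :
  hom_cast em en (box_mor f) = box_mor (hom_cast em en f).
Proof. by case: m' / em; case: n' / en. Qed.

Lemma box_tensA m n m' n' m'' n''
    (f : box_hom m n) (g : box_hom m' n') (h : box_hom m'' n'') :
  hom_cast (addnA m m' m'') (addnA n n' n'') (box_tens f (box_tens g h))
  = box_tens (box_tens f g) h.
Proof.
elim/box_ind: f => [[S T d c a b]]; elim/box_ind: g => [[S' T' d' c' a' b']].
elim/box_ind: h => [[S'' T'' d'' c'' a'' b'']].
rewrite !box_tens_class hom_cast_box; apply/box_classP; rewrite /quad_tens /=.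
by apply: (quad_eqv_cast (eS := addnA _ _ _) (eT := addnA _ _ _));
  rewrite ?castmx_comp -dsumA hom_cast_lmap; apply: eq_castmx.
Qed.

Lemma box_tens0m m n (f : box_hom m n) :
  hom_cast (add0n m) (add0n n) (box_tens (box_id 0) f) = f.
Proof.
elim/box_ind: f => [[S T d c a b]].
rewrite box_tens_class hom_cast_box; apply/box_classP; rewrite /quad_tens /=.
have E1 : (0 : lmap 0 0) = 1%:M by apply/matrixP => -[].
by apply: (quad_eqv_cast (eS := add0n _) (eT := add0n _));
  rewrite ?castmx_comp ?E1 -[RHS]dsum0m hom_cast_lmap; apply: eq_castmx.
Qed.

Lemma box_tensm0 m n (f : box_hom m n) :
  hom_cast (addn0 m) (addn0 n) (box_tens f (box_id 0)) = f.
Proof.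
elim/box_ind: f => [[S T d c a b]].
rewrite box_tens_class hom_cast_box; apply/box_classP; rewrite /quad_tens /=.
have E1 : (0 : lmap 0 0) = 1%:M by apply/matrixP => -[].
by apply: (quad_eqv_cast (eS := addn0 _) (eT := addn0 _));
  rewrite ?castmx_comp ?E1 -[RHS]dsumm0 hom_cast_lmap; apply: eq_castmx.
Qed.

Lemma box_swap_nat m n m' n' (f : box_hom m n) (g : box_hom m' n') :
  box_comp (box_swap n n') (box_tens f g) = box_comp (box_tens g f) (box_swap m m').
Proof.
elim/box_ind: f => [[S T d c a b]]; elim/box_ind: g => [[S' T' d' c' a' b']].
rewrite !box_tens_class box_mor_compl box_mor_compr /=; apply/box_classP.
split=> /=; first by rewrite swap_nat.
exists (swap k S S'), (swap k T T'); split; rewrite /= ?swap_nat //.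
- by exists (swap k S' S); rewrite !swapK.
- by exists (swap k T' T); rewrite !swapK.
Qed.

Lemma box_swapK m n : box_comp (box_swap n m) (box_swap m n) = box_id (m + n).
Proof. by rewrite box_comp_mor swapK. Qed.

Lemma box_swap_hex m n p :
  box_swap m (n + p)
  = box_comp
      (hom_cast erefl (addnA n p m) (box_tens (box_id n) (box_swap m p)))
      (hom_cast (esym (addnA m n p)) (esym (addnA n m p))
         (box_tens (box_swap m n) (box_id p))).
Proof.
rewrite !box_tens_mor (hom_cast_box_mor erefl) hom_cast_box_mor box_comp_mor.
by rewrite -swap_hex.
Qed.

Definition BoxFinVect : PROP := @MkPROP
  box_hom box_id box_comp box_comp1m box_compm1 box_compA
  box_tens box_tens_id box_tens_comp box_tensA box_tens0m box_tensm0
  box_swap box_swap_nat box_swapK box_swap_hex.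

(* eval and feed on classes are computed on representatives. *)
Definition eval_mor m n (x : box_hom m n) : lmap m n :=
  let q := box_repr x in quad_d q + quad_c q *m quad_a q *m quad_b q.

Definition feed_mor m n (x : box_hom m n) : lmap m n := quad_d (box_repr x).

End Box.

(* Main.v *)
Require Import Defs.
From mathcomp Require Import all_boot all_algebra.

(** Evaluation and feed-through are invariants of the class of a quadruple and
are compatible with composition and direct sum by block matrix computation.
Both are retractions of [box_mor] on morphisms, which makes them full and
makes [box_mor] faithful.

All the negative assertions come from one morphism. A quadruple is determined
only up to isomorphism of its intermediate spaces, but the dimensions of these
spaces are invariants ([box_class_dims]). Hence the endomorphism [stub] of the
object 0, whose first intermediate space is a line, is not the identity of 0
nor the image of any matrix, although [eval_mor] and [feed_mor] send it to
the only endomorphism of the zero space. Thus 0, a zero object of vector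
spaces, is neither terminal nor initial in the category of boxes. A terminal
object is a limit of the empty diagram, and a functor that has a left adjoint
preserves terminal objects ([preserves_limits_terminal],
[has_left_adjoint_terminal]); together with the dual facts this excludes
preservation of limits or colimits and the existence of adjoints. *)

Set Implicit Arguments.
Unset Strict Implicit.
Unset Printing Implicit Defensive.

Import GRing.Theory.

Local Open Scope ring_scope.

(** * Terminal and initial objects *)

Section TerminalInitial.
Local Open Scope cat_scope.
Local Notation hom := Defs.hom.

Definition terminal (C : category) (z : C) : Prop :=
  forall x : C, exists f : hom x z, forall g, g = f.

Definition initial (C : category) (z : C) : Prop :=
  forall x : C, exists f : hom z x, forall g, g = f.

Definition empty_category : category :=
  @Category void (fun _ _ => unit) (fun _ => tt) (fun _ _ _ _ _ => tt)
    (fun x => match x with end) (fun x => match x with end)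
    (fun x => match x with end).

Definition empty_map (C : category) (x : empty_category) : C :=
  match x with end.

Definition empty_mor (C : category) (x y : empty_category) :
    hom x y -> hom (empty_map C x) (empty_map C y) :=
  match x with end.

Lemma empty_functorP (C : category) : is_functor (@empty_mor C).
Proof. by split=> -[]. Qed.

Definition empty_functor (C : category) : functor empty_category C :=
  Functor (empty_functorP C).

(** Every object carries exactly one cone over the empty diagram, so that being
a limit of this diagram is the same as being terminal. *)
Lemma preserves_limits_terminal (C D : category) (F : functor C D) (z : C) :
  preserves_limits F -> terminal z -> terminal (F z).
Proof.
move=> presF z_term y.
pose p (j : empty_category) : hom z (empty_functor C j) := match j with end.
have limp : is_limit p.
  split=> [[] | x q _]; have [f fE] := z_term x.
  by exists f; split=> [[] | g _]; rewrite (fE g).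
have [_ univ] := presF _ _ _ _ limp.
have [|f [_ fE]] := univ y (fun j => match j with end); first by case.
by exists f => g; rewrite -(fE g) // => -[].
Qed.

Lemma preserves_colimits_initial (C D : category) (F : functor C D) (z : C) :
  preserves_colimits F -> initial z -> initial (F z).
Proof.
move=> presF z_init y.
pose p (j : empty_category) : hom (empty_functor C j) z := match j with end.
have colimp : is_colimit p.
  split=> [[] | x q _]; have [f fE] := z_init x.
  by exists f; split=> [[] | g _]; rewrite (fE g).
have [_ univ] := presF _ _ _ _ colimp.
have [|f [_ fE]] := univ y (fun j => match j with end); first by case.
by exists f => g; rewrite -(fE g) // => -[].
Qed.

(** The adjunction identifies maps into [F z] with maps into [z]. *)
Lemma has_left_adjoint_terminal (C D : category) (F : functor C D) (z : C) :
  has_left_adjoint F -> terminal z -> terminal (F z).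
Proof.
move=> [G [phi [phi_bij _ _]]] z_term y.
have [f fE] := z_term (G y); exists (phi y z f) => g.
by have [psi _ psiK] := phi_bij y z; rewrite -(psiK g) (fE (psi g)).
Qed.

Lemma has_right_adjoint_initial (C D : category) (F : functor C D) (z : C) :
  has_right_adjoint F -> initial z -> initial (F z).
Proof.
move=> [G [phi [phi_bij _ _]]] z_init y.
have [f fE] := z_init (G y); have [psi phiK _] := phi_bij z y.
by exists (psi f) => g; rewrite -(phiK g) (fE (phi z y g)).
Qed.

End TerminalInitial.

Section Main.
Variable k : fieldType.
Local Notation lmap := (lmap k).

(** * Evaluation, feed-through and their functoriality *)

(** Moving the isomorphisms of the equivalence through the product turns
[c *m a *m b] into the corresponding product for [q']. *)
Lemma quad_eqv_eval m n (q q' : quad k m n) : quad_eqv q q' ->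
  quad_d q + quad_c q *m quad_a q *m quad_b q
  = quad_d q' + quad_c q' *m quad_a q' *m quad_b q'.
Proof.
move=> [-> [u [w [_ _ <- Ea ->]]]].
by rewrite -(mulmxA _ w) Ea !mulmxA.
Qed.

Lemma eval_box_class m n s t (d : lmap m n) (c : lmap t n) (a : lmap s t)
    (b : lmap m s) :
  eval_mor (box_class (Quad d c a b)) = d + c *m a *m b.
Proof. exact: quad_eqv_eval (box_repr_class (Quad d c a b)). Qed.

Lemma feed_box_class m n s t (d : lmap m n) (c : lmap t n) (a : lmap s t)
    (b : lmap m s) :
  feed_mor (box_class (Quad d c a b)) = d.
Proof. by have [] := box_repr_class (Quad d c a b). Qed.

Lemma box_morK m n : cancel (@box_mor k m n) (@feed_mor k m n).
Proof. by move=> d; rewrite feed_box_class. Qed.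

Lemma box_mor_evalK m n : cancel (@box_mor k m n) (@eval_mor k m n).
Proof. by move=> d; rewrite eval_box_class mulmx0 addr0. Qed.

(** The corner [a' *m b' *m c *m a] in the composite quadruple supplies exactly
the cross term of the expansion of the product of the two evaluations. *)
Lemma eval_is_functor : @is_functor (BoxFinVect k) (FinVect k) id (@eval_mor k).
Proof.
split=> [n | m n p y x]; first exact: box_mor_evalK.
elim/box_ind: x => [[S T d c a b]]; elim/box_ind: y => [[S' T' d' c' a' b']].
rewrite /= box_comp_class !eval_box_class.
rewrite mul_row_block mul_row_col mulmx0 add0r.
rewrite !mulmxDl !mulmxDr !mulmxA -!addrA; congr (_ + (_ + _)).
exact: addrC.
Qed.

Lemma feed_is_functor : @is_functor (BoxFinVect k) (FinVect k) id (@feed_mor k).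
Proof.
split=> [n | m n p y x]; first exact: box_morK.
elim/box_ind: x => [[S T d c a b]]; elim/box_ind: y => [[S' T' d' c' a' b']].
by rewrite /= box_comp_class !feed_box_class.
Qed.

Lemma box_is_functor : @is_functor (FinVect k) (BoxFinVect k) id (@box_mor k).
Proof. by split=> // m n p g f; rewrite /= box_comp_mor. Qed.

Definition eval_functor := Functor eval_is_functor.
Definition feed_functor := Functor feed_is_functor.
Definition box_functor := Functor box_is_functor.

(** * Compatibility with the monoidal structure *)

Lemma eval_PROP_morphism : PROP_morphism eval_functor.
Proof.
exists (fun m n => erefl); split=> // [m n m' n' x y | m n] /=; last first.
  exact: box_mor_evalK.
elim/box_ind: x => [[S T d c a b]]; elim/box_ind: y => [[S' T' d' c' a' b']].
rewrite box_tens_class !eval_box_class -!dsum_comp.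
by rewrite /dsum add_block_mx !addr0.
Qed.

Lemma feed_PROP_morphism : PROP_morphism feed_functor.
Proof.
exists (fun m n => erefl); split=> // [m n m' n' x y | m n] /=; last first.
  exact: box_morK.
elim/box_ind: x => [[S T d c a b]]; elim/box_ind: y => [[S' T' d' c' a' b']].
by rewrite box_tens_class !feed_box_class.
Qed.

Lemma box_PROP_morphism : PROP_morphism box_functor.
Proof.
by exists (fun m n => erefl); split=> // m n m' n' f g; rewrite /= box_tens_mor.
Qed.

(** * The dimensions of the intermediate spaces *)

Lemma is_iso_dim m n (f : lmap m n) : is_iso f -> m = n.
Proof.
have retr_leq p q (r : lmap q p) (i : lmap p q) : r *m i = 1%:M -> (p <= q)%N.
  by move=> ri; rewrite -(mxrank1 k p) -ri mulmx_max_rank.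
by move=> [g [/retr_leq mn /retr_leq nm]]; apply/eqP; rewrite eqn_leq mn.
Qed.

Lemma box_class_dims m n (q q' : quad k m n) :
  box_class q = box_class q' -> quad_S q = quad_S q' /\ quad_T q = quad_T q'.
Proof.
by move=> /box_classP[_ [u [w [/is_iso_dim iu /is_iso_dim iw _ _ _]]]].
Qed.

Definition stub : box_hom k 0 0 := box_class (@Quad k 0 0 1 0 0 0 0 0).

Lemma stub_neq_box_mor (d : lmap 0 0) : stub <> box_mor d.
Proof. by move=> /box_class_dims[]. Qed.

Lemma not_faithful_stub (D : PROP) (F : functor (BoxFinVect k) D) :
  fmor F (stub : @Defs.hom (BoxFinVect k) 0%N 0%N)
    = fmor F (@idm (BoxFinVect k) 0%N) -> ~ faithful F.
Proof.
by move=> eqF injF; apply: (@stub_neq_box_mor 1%:M (injF _ _ _ _ eqF)).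
Qed.

(** * The zero object *)

Lemma FinVect_terminal0 : @terminal (FinVect k) 0%N.
Proof. by move=> m; exists 0 => g; apply: flatmx0. Qed.

Lemma FinVect_initial0 : @initial (FinVect k) 0%N.
Proof. by move=> m; exists 0 => g; apply: thinmx0. Qed.

Lemma BoxFinVect_not_terminal0 : ~ @terminal (BoxFinVect k) 0%N.
Proof.
move=> /(_ 0%N)[f fE]; apply: (@stub_neq_box_mor 0).
by rewrite (fE stub) (fE (box_mor 0)).
Qed.

Lemma BoxFinVect_not_initial0 : ~ @initial (BoxFinVect k) 0%N.
Proof.
move=> /(_ 0%N)[f fE]; apply: (@stub_neq_box_mor 0).
by rewrite (fE stub) (fE (box_mor 0)).
Qed.

End Main.

Theorem mainTheorem4 (k : fieldType) :
  [/\ forall (m n s t : nat) (d : lmap k m n) (c : lmap k t n) (a : lmap k s t)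
        (b : lmap k m s),
        eval_mor (box_class (Quad d c a b)) = d + c *m a *m b,
      forall (m n s t : nat) (d : lmap k m n) (c : lmap k t n) (a : lmap k s t)
        (b : lmap k m s),
        feed_mor (box_class (Quad d c a b)) = d,
      forall (m n : nat) (d : lmap k m n),
        box_mor d = box_class (@Quad k m n 0%N 0%N d 0 0 0)
    & exists (evalP : @is_functor (BoxFinVect k) (FinVect k) id (@eval_mor k))
             (feedP : @is_functor (BoxFinVect k) (FinVect k) id (@feed_mor k))
             (boxP : @is_functor (FinVect k) (BoxFinVect k) id (@box_mor k)),
      let eval := Functor evalP in
      let feed := Functor feedP in
      let Box := Functor boxP in
      [/\ [/\ PROP_morphism eval, PROP_morphism feed & PROP_morphism Box],
          [/\ full eval, ~ faithful eval, full feed & ~ faithful feed],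
          faithful Box /\ ~ full Box
        & [/\ ~ preserves_limits Box, ~ preserves_colimits Box,
              ~ has_left_adjoint Box & ~ has_right_adjoint Box]]].
Proof.
split; [exact: eval_box_class | exact: feed_box_class | by [] |].
exists (eval_is_functor k), (feed_is_functor k), (box_is_functor k).
split.
- split; [exact: eval_PROP_morphism | exact: feed_PROP_morphism |].
  exact: box_PROP_morphism.
- split.
  + by move=> m n g; exists (box_mor g); apply: box_mor_evalK.
  + by apply: not_faithful_stub; rewrite /= [LHS]flatmx0 [RHS]flatmx0.
  + by move=> m n g; exists (box_mor g); apply: box_morK.
  + by apply: not_faithful_stub; rewrite /= [LHS]flatmx0 [RHS]flatmx0.
- split; first by move=> m n; apply: can_inj (@box_morK k m n).
  by move=> /(_ 0%N 0%N (stub k))[d /esym/stub_neq_box_mor].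
- have term0 := @FinVect_terminal0 k; have init0 := @FinVect_initial0 k.
  split.
  + by move=> /preserves_limits_terminal/(_ term0)/BoxFinVect_not_terminal0.
  + by move=> /preserves_colimits_initial/(_ init0)/BoxFinVect_not_initial0.
  + by move=> /has_left_adjoint_terminal/(_ term0)/BoxFinVect_not_terminal0.
  + by move=> /has_right_adjoint_initial/(_ init0)/BoxFinVect_not_initial0.
Qed.
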